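(* Let $P$ be a non-invertible bounded normal operator in a Hilbert space $\mathcal H$, and suppose either there exists $\gamma\in(0,\pi/2)$ such that $\sigma(P)\subset\overline{\mathcal C_\gamma}$, or $\gamma=0$ and $P$ is non-negative self-adjoint. Then (a) for $q\in(-\mathcal C_{\pi-\gamma})\cup\mathcal D(0,1/\|P\|)$, $I-qP$ is invertible and $\|(I-qP)^{-1}\|=\max_{\lambda\in\sigma(P)}|1-q\lambda|^{-1}$; (b) for any $\gamma'\in(\gamma,\pi/2)$, $\|(I-qP)^{-1}\|\le 1/\sin(\gamma'-\gamma)$ for all $q\in-\mathcal C_{\pi-\gamma'}$; (c) for any $r\in(0,1)$ there exists $C(r)$ independent of $\gamma$ such that if $\sin\gamma\in(0,1-r)$, then $\|(I-qP)^{-1}\|\le C(r)/|1-q\|P\||$ for all $q\in\mathcal D(0,(1-\sin\gamma)/\|P\|)$; (d) if $P\ge0$ is self-adjoint, then $\|(I-qP)^{-1}\|\le 4/|1-q\|P\||$ for all $q\in\mathcal D(0,1/\|P\|)$.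
   Context: $\mathcal C_\gamma=\{\rho e^{i\varphi}:\rho>0,\ \varphi\in(-\gamma,\gamma)\}$ (for $\gamma=0$ its closure is understood as $[0,+\infty)$), $-\mathcal C_\gamma=\{-z:z\in\mathcal C_\gamma\}$, an overline denotes closure, $\sigma(P)$ is the spectrum of $P$, and $\mathcal D(0,r)$ is the open disc of radius $r$ centered at $0$. *)

(* Defs.v *)
From HB Require Import structures.
From mathcomp Require Import all_boot all_order all_algebra.
From mathcomp Require Import all_classical all_reals.
From mathcomp Require Import complex trigo.

Set Implicit Arguments.
Unset Strict Implicit.
Unset Printing Implicit Defensive.

Import Order.TTheory GRing.Theory Num.Theory.
Local Open Scope ring_scope.
Local Open Scope complex_scope.

Definition cmod (R : realType) (z : R[i]) : R :=
  Num.sqrt (complex.Re z ^+ 2 + complex.Im z ^+ 2).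

Definition cexpi (R : realType) (phi : R) : R[i] := cos phi +i* sin phi.

Definition sector (R : realType) (gamma : R) (z : R[i]) : Prop :=
  exists rho phi : R, 0 < rho /\ - gamma < phi < gamma /\ z = rho%:C * cexpi phi.

Definition neg_sector (R : realType) (gamma : R) (z : R[i]) : Prop :=
  sector gamma (- z).

Definition cclosure (R : realType) (S : R[i] -> Prop) (z : R[i]) : Prop :=
  forall e : R, 0 < e -> exists w, S w /\ cmod (z - w) < e.

Record hilbert (R : realType) := Hilbert {
  hcarrier :> lmodType R[i];
  inner : hcarrier -> hcarrier -> R[i];
  inner_linl : forall (a : R[i]) (x y z : hcarrier),
      inner (a *: x + y) z = a * inner x z + inner y z;
  inner_conj : forall x y : hcarrier, inner y x = (inner x y)^*;
  inner_ge0 : forall x : hcarrier, 0 <= inner x x;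
  inner_eq0 : forall x : hcarrier, inner x x = 0 -> x = 0;
  hcomplete : forall u : nat -> hcarrier,
      (forall e : R, 0 < e -> exists N, forall m n, (N <= m)%N -> (N <= n)%N ->
         Num.sqrt (complex.Re (inner (u m - u n) (u m - u n))) < e) ->
      exists x, forall e : R, 0 < e -> exists N, forall n, (N <= n)%N ->
         Num.sqrt (complex.Re (inner (u n - x) (u n - x))) < e
}.

Section Ops.
Variables (R : realType) (H : hilbert R).

Definition hnorm (x : H) : R := Num.sqrt (complex.Re (inner x x)).

Definition linear_op (P : H -> H) : Prop :=
  forall (a : R[i]) (x y : H), P (a *: x + y) = a *: P x + P y.

Definition bounded_op (P : H -> H) : Prop :=
  linear_op P /\ exists M : R, forall x, hnorm (P x) <= M * hnorm x.

Definition opnorm (P : H -> H) : R :=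
  sup [set t : R | exists x : H, hnorm x <= 1 /\ t = hnorm (P x)].

Definition is_inverse (P Q : H -> H) : Prop :=
  bounded_op Q /\ (forall x, P (Q x) = x) /\ (forall x, Q (P x) = x).

Definition invertible (P : H -> H) : Prop := exists Q, is_inverse P Q.

Definition spectrum (P : H -> H) (l : R[i]) : Prop :=
  ~ invertible (fun x => l *: x - P x).

Definition IqP (q : R[i]) (P : H -> H) : H -> H := fun x => x - q *: P x.

Definition normal_op (P : H -> H) : Prop :=
  exists Ps : H -> H, (forall x y, inner (P x) y = inner x (Ps y)) /\
                      (forall x, P (Ps x) = Ps (P x)).

Definition nonneg_selfadjoint (P : H -> H) : Prop :=
  (forall x y, inner (P x) y = inner x (P y)) /\ (forall x, 0 <= inner (P x) x).

Definition thm32_hyp (P : H -> H) (gamma : R) : Prop :=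
  bounded_op P /\ normal_op P /\ ~ invertible P /\
  ((0 < gamma < pi / 2 /\ (forall l, spectrum P l -> cclosure (sector gamma) l))
   \/ (gamma = 0 /\ nonneg_selfadjoint P)).

End Ops.

(* Main.v *)
(** The norm identity rests on the fact that a normal operator attains its norm
    as the modulus of a spectral point.  The power inequality
    w(T^2) <= w(T)^2 for the numerical radius w, the bound ||T|| <= 2 w(T) and
    ||N^2|| = ||N||^2 for normal N give ||N|| <= 2^(1/2^k) w(N) for every k,
    hence w(N) = ||N||; a cluster point mu of values (N x, x) at unit vectors,
    with |mu| = ||N||, is then an approximate eigenvalue.  This is applied to
    N = (I - q P)^-1.  Invertibility comes from the Neumann iteration, also in
    the form of the Lax-Milgram lemma, which places the spectrum of P >= 0 in
    [0, +oo).  The remaining estimates are plane geometry: with l = t e^(i psi)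
    in the spectrum, |psi| <= gamma and t <= ||P||, (b) minimises
    |1 + s e^(i theta)| over |theta| <= pi - (gamma' - gamma), and in (c) and (d)
    |1 - q ||P||| <= 4 |1 - q l|, so that C(r) = 4 works for every r. *)

Require Import Defs.
From HB Require Import structures.
From mathcomp Require Import all_boot all_order all_algebra.
From mathcomp Require Import all_classical all_reals.
From mathcomp Require Import complex topology normedtype sequences trigo.
From mathcomp Require Import ring lra.

Set Implicit Arguments.
Unset Strict Implicit.
Unset Printing Implicit Defensive.

Import Order.TTheory GRing.Theory Num.Theory.
Import numFieldNormedType.Exports.
Local Open Scope ring_scope.
Local Open Scope complex_scope.

Local Notation Re := complex.Re.
Local Notation Im := complex.Im.

(** * The modulus as a real number *)

Section ComplexModulus.
Variable R : realType.
Implicit Types z w : R[i].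

(** Bridge to the complex-valued norm: properties of the norm pass to [cmod] through the injective
    embedding of the reals. *)
Lemma cmodE z : (cmod z)%:C = `|z|.
Proof. by rewrite normc_def. Qed.

Lemma cmod_ge0 z : 0 <= cmod z.
Proof. exact: sqrtr_ge0. Qed.

Lemma cmodM z w : cmod (z * w) = cmod z * cmod w.
Proof. by apply: (@complexI R); rewrite rmorphM /= !cmodE normrM. Qed.

Lemma cmodV z : cmod z^-1 = (cmod z)^-1.
Proof. by apply: (@complexI R); rewrite fmorphV /= !cmodE normfV. Qed.

Lemma cmodD z w : cmod (z + w) <= cmod z + cmod w.
Proof. by rewrite -lecR rmorphD /= !cmodE ler_normD. Qed.

Lemma cmodN z : cmod (- z) = cmod z.
Proof. by apply: (@complexI R); rewrite !cmodE normrN. Qed.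

Lemma cmodJ z : cmod z^* = cmod z.
Proof. by apply: (@complexI R); rewrite !cmodE normcJ. Qed.

Lemma cmod_eq0 z : (cmod z == 0) = (z == 0).
Proof. by rewrite -(inj_eq (@complexI R)) cmodE normr_eq0. Qed.

Lemma cmod_real (r : R) : cmod r%:C = `|r|.
Proof. by rewrite /cmod /= expr0n addr0 sqrtr_sqr. Qed.

Lemma cmod0 : cmod (0 : R[i]) = 0.
Proof. by apply/eqP; rewrite cmod_eq0. Qed.

Lemma cmod1 : cmod (1 : R[i]) = 1.
Proof. by rewrite (cmod_real 1) normr1. Qed.

Lemma sqr_cmod z : cmod z ^+ 2 = Re z ^+ 2 + Im z ^+ 2.
Proof. by rewrite sqr_sqrtr // addr_ge0 // sqr_ge0. Qed.

Lemma mulcJ z : z * z^*%C = (cmod z ^+ 2)%:C.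
Proof. by rewrite rmorphXn /= cmodE sqr_normc. Qed.

Lemma Re_le_cmod z : `|Re z| <= cmod z.
Proof. by rewrite -lecR cmodE normc_ge_Re. Qed.

Lemma Im_le_cmod z : `|Im z| <= cmod z.
Proof. by rewrite -sqrtr_sqr ler_wsqrtr // lerDr sqr_ge0. Qed.

Lemma ReD z w : Re (z + w) = Re z + Re w.
Proof. by case: z; case: w. Qed.

Lemma ReN z : Re (- z) = - Re z.
Proof. by case: z. Qed.

Lemma ReB z w : Re (z - w) = Re z - Re w.
Proof. by rewrite ReD ReN. Qed.

Lemma ReMl (r : R) z : Re (r%:C * z) = r * Re z.
Proof. by case: z => a b /=; rewrite mul0r subr0. Qed.

Lemma ReJ z : Re z^* = Re z.
Proof. by case: z. Qed.

(** Rotating by u = conj(z) / |z| reduces bounds on a modulus to bounds on a real part. *)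
Lemma cmod_Re z : exists2 u : R[i], cmod u = 1 & Re (u * z) = cmod z.
Proof.
have [->|z0] := eqVneq z 0; first by exists 1; rewrite ?cmod1 // mulr0 cmod0.
have cz0 : cmod z != 0 by rewrite cmod_eq0.
exists ((cmod z)^-1%:C * z^*%C).
  by rewrite cmodM cmod_real cmodJ ger0_norm ?invr_ge0 ?cmod_ge0 // mulVf.
by rewrite -mulrA ReMl [_^*%C * z]mulrC mulcJ /= expr2 mulrA mulVf // mul1r.
Qed.

End ComplexModulus.

(** * Inner product, norm and the Cauchy-Schwarz inequality *)

Section HilbertSpace.
Variables (R : realType) (H : hilbert R).
Implicit Types (x y z : H) (a : R[i]).

Lemma innerDl x y z : inner (x + y) z = inner x z + inner y z.
Proof. by rewrite -[x]scale1r inner_linl mul1r scale1r. Qed.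

Lemma inner0l z : inner (0 : H) z = 0.
Proof. by apply: (addrI (inner 0 z)); rewrite -innerDl !addr0. Qed.

Lemma innerZl a x z : inner (a *: x) z = a * inner x z.
Proof. by rewrite -[a *: x]addr0 inner_linl inner0l addr0. Qed.

Lemma innerNl x z : inner (- x) z = - inner x z.
Proof. by rewrite -scaleN1r innerZl mulN1r. Qed.

Lemma innerBl x y z : inner (x - y) z = inner x z - inner y z.
Proof. by rewrite innerDl innerNl. Qed.

Lemma innerDr x y z : inner x (y + z) = inner x y + inner x z.
Proof. by rewrite inner_conj innerDl rmorphD /= -!inner_conj. Qed.

Lemma innerZr a x z : inner x (a *: z) = a^*%C * inner x z.
Proof. by rewrite inner_conj innerZl rmorphM /= -inner_conj. Qed.

Lemma innerNr x z : inner x (- z) = - inner x z.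
Proof. by rewrite inner_conj innerNl rmorphN /= -inner_conj. Qed.

Lemma innerBr x y z : inner x (y - z) = inner x y - inner x z.
Proof. by rewrite innerDr innerNr. Qed.

Lemma inner0r x : inner x (0 : H) = 0.
Proof. by rewrite inner_conj inner0l conjc0. Qed.

Lemma hnorm_ge0 x : 0 <= hnorm x.
Proof. exact: sqrtr_ge0. Qed.

Lemma sqr_hnorm x : hnorm x ^+ 2 = Re (inner x x).
Proof. by rewrite sqr_sqrtr //; have := inner_ge0 x; rewrite lecE => /andP[]. Qed.

Lemma inner_self x : inner x x = (hnorm x ^+ 2)%:C.
Proof.
rewrite sqr_hnorm; have := inner_ge0 x.
by case: (inner x x) => a b; rewrite lecE /= => /andP[/eqP -> _].
Qed.

Lemma hnorm0 : hnorm (0 : H) = 0.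
Proof. by rewrite /hnorm inner0l sqrtr0. Qed.

Lemma hnorm_eq0 x : (hnorm x == 0) = (x == 0).
Proof.
apply/eqP/eqP => [x0|->]; last exact: hnorm0.
by apply: inner_eq0; rewrite inner_self x0 expr0n.
Qed.

Lemma hnormZ a x : hnorm (a *: x) = cmod a * hnorm x.
Proof.
rewrite {1}/hnorm innerZl innerZr mulrA mulcJ ReMl -sqr_hnorm -exprMn.
by rewrite sqrtr_sqr ger0_norm // mulr_ge0 ?cmod_ge0 ?hnorm_ge0.
Qed.

Lemma hnormN x : hnorm (- x) = hnorm x.
Proof. by rewrite -scaleN1r hnormZ cmodN cmod1 mul1r. Qed.

Lemma sqr_hnormD x y :
  hnorm (x + y) ^+ 2 = hnorm x ^+ 2 + 2 * Re (inner x y) + hnorm y ^+ 2.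
Proof.
rewrite !sqr_hnorm !innerDl !innerDr !ReD (inner_conj x y) ReJ; ring.
Qed.

Lemma sqr_hnormB x y :
  hnorm (x - y) ^+ 2 = hnorm x ^+ 2 - 2 * Re (inner x y) + hnorm y ^+ 2.
Proof. by rewrite sqr_hnormD hnormN innerNr ReN mulrN. Qed.

Lemma cauchy_schwarz x y : cmod (inner x y) <= hnorm x * hnorm y.
Proof.
have [->|y0] := eqVneq y 0; first by rewrite inner0r cmod0 hnorm0 mulr0.
have ny : 0 < hnorm y by rewrite lt_def hnorm_ge0 hnorm_eq0 y0.
(* The vector is ||y||^2 times the component of x orthogonal to y; its squared norm is ||y||^2
   (||x||^2 ||y||^2 - |(x, y)|^2). *)
have := sqr_ge0 (hnorm ((hnorm y ^+ 2)%:C *: x - inner x y *: y)).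
rewrite sqr_hnormB !hnormZ innerZl innerZr cmod_real ger0_norm ?sqr_ge0 //.
rewrite ReMl [_^*%C * _]mulrC mulcJ /= => h.
rewrite -(@ler_pXn2r _ 2) ?nnegrE ?mulr_ge0 ?cmod_ge0 ?hnorm_ge0 //.
have : 0 <= hnorm y ^+ 2 * ((hnorm x * hnorm y) ^+ 2 - cmod (inner x y) ^+ 2).
  by apply: le_trans h _; rewrite le_eqVlt; apply/orP; left; apply/eqP; ring.
by rewrite pmulr_rge0 ?exprn_gt0 // subr_ge0.
Qed.

Lemma Re_inner_le x y : Re (inner x y) <= hnorm x * hnorm y.
Proof.
apply: le_trans (cauchy_schwarz x y).
exact: le_trans (ler_norm _) (Re_le_cmod _).
Qed.

Lemma hnormD x y : hnorm (x + y) <= hnorm x + hnorm y.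
Proof.
rewrite -(@ler_pXn2r _ 2) ?nnegrE ?addr_ge0 ?hnorm_ge0 // sqr_hnormD.
have := Re_inner_le x y; lra.
Qed.

Lemma hnormB x y : hnorm (x - y) <= hnorm x + hnorm y.
Proof. by rewrite -(hnormN y) hnormD. Qed.

End HilbertSpace.

(** * Bounded operators and criteria for invertibility *)

Section Operators.
Variables (R : realType) (H : hilbert R).
Implicit Types (A B P Q T : H -> H) (x y : H).

Lemma linear_op0 T : linear_op T -> T 0 = 0.
Proof.
move=> lT; apply: (addrI (T 0)); rewrite -{1}[T 0]scale1r -lT.
by rewrite scaler0 !addr0.
Qed.

Lemma linear_opD T : linear_op T -> {morph T : x y / x + y}.
Proof. by move=> lT x y; rewrite -[x]scale1r lT !scale1r. Qed.

Lemma linear_opZ T : linear_op T -> forall a, {morph T : x / a *: x}.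
Proof. by move=> lT a x; rewrite -[a *: x]addr0 lT linear_op0 // addr0. Qed.

Lemma linear_opN T : linear_op T -> {morph T : x / - x}.
Proof. by move=> lT x; rewrite -scaleN1r linear_opZ // scaleN1r. Qed.

Lemma linear_opB T : linear_op T -> {morph T : x y / x - y}.
Proof. by move=> lT x y; rewrite linear_opD // linear_opN. Qed.

Lemma linear_op_comp A B : linear_op A -> linear_op B -> linear_op (A \o B).
Proof. by move=> lA lB a x y; rewrite /= lB lA. Qed.

Lemma linear_op_scale a T : linear_op T -> linear_op (fun x => a *: T x).
Proof. by move=> lT b x y; rewrite lT scalerDr !scalerA mulrC. Qed.

Lemma linear_op_sub A B :
  linear_op A -> linear_op B -> linear_op (fun x => A x - B x).
Proof. by move=> lA lB a x y; rewrite lA lB scalerBr opprD addrACA. Qed.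

Lemma linear_op_id : linear_op (@id H).
Proof. by []. Qed.

Lemma bounded_op_gt0 T : bounded_op T ->
  exists2 M : R, 0 < M & forall x, hnorm (T x) <= M * hnorm x.
Proof.
move=> [_ [M hM]]; exists (`|M| + 1) => [|x]; first by rewrite ltr_wpDl.
apply: le_trans (hM x) _; apply: ler_wpM2r; first exact: hnorm_ge0.
by rewrite (le_trans (ler_norm _)) // lerDl.
Qed.

Lemma bounded_op_comp A B : bounded_op A -> bounded_op B -> bounded_op (A \o B).
Proof.
move=> bA bB; split; first exact: linear_op_comp bA.1 bB.1.
have [M M0 hM] := bounded_op_gt0 bA; have [N _ hN] := bounded_op_gt0 bB.
exists (M * N) => x; apply: le_trans (hM _) _.
by rewrite -mulrA ler_pM2l.
Qed.

Lemma bounded_op_scale a T : bounded_op T -> bounded_op (fun x => a *: T x).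
Proof.
move=> bT; split; first exact: linear_op_scale bT.1.
have [M _ hM] := bounded_op_gt0 bT; exists (cmod a * M) => x.
by rewrite hnormZ -mulrA ler_wpM2l // cmod_ge0.
Qed.

Lemma bounded_op_sub A B :
  bounded_op A -> bounded_op B -> bounded_op (fun x => A x - B x).
Proof.
move=> bA bB; split; first exact: linear_op_sub bA.1 bB.1.
have [M _ hM] := bounded_op_gt0 bA; have [N _ hN] := bounded_op_gt0 bB.
by exists (M + N) => x; rewrite (le_trans (hnormB _ _)) // mulrDl lerD.
Qed.

Lemma bounded_op_id : bounded_op (@id H).
Proof. by split=> //; exists 1 => x; rewrite mul1r. Qed.

Lemma invertible_comp A B : invertible A -> invertible B -> invertible (A \o B).
Proof.
move=> [A' [bA [AK KA]]] [B' [bB [BK KB]]]; exists (B' \o A'); split.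
  exact: bounded_op_comp.
by split=> x /=; rewrite ?BK ?KA.
Qed.

Lemma invertible_scale (a : R[i]) A : a != 0 ->
  invertible (fun x => a *: A x) -> invertible A.
Proof.
move=> a0 [Q [bQ [AK KA]]]; exists (fun x => a *: Q x); split.
  exact: bounded_op_scale.
split=> x; last by rewrite -(linear_opZ bQ.1) KA.
by apply: (scalerI a0); rewrite -(linear_opZ bQ.1) AK.
Qed.

(** Surjectivity lets a right inverse be chosen; the lower bound gives injectivity, which makes the
    choice linear and two-sided, and bounds it by 1/c. *)
Lemma bounded_below_invertible A (c : R) : linear_op A -> 0 < c ->
  (forall x, c * hnorm x <= hnorm (A x)) -> (forall y, exists x, A x = y) ->
  invertible A.
Proof.
move=> lA c0 hA /choice[Q AK].
have injA : injective A.
  move=> x y Axy; apply/eqP; rewrite -subr_eq0 -hnorm_eq0.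
  have := hA (x - y); rewrite linear_opB // Axy subrr hnorm0 pmulr_rle0 // => h.
  by rewrite eq_le h hnorm_ge0.
exists Q; split; last by split=> // x; apply: injA; rewrite AK.
split; first by move=> a x y; apply: injA; rewrite lA !AK.
by exists c^-1 => x; rewrite ler_pdivlMl // (le_trans (hA _)) // AK.
Qed.

Lemma expr_small (k c e : R) : 0 <= k < 1 -> 0 < e ->
  exists N, forall n, (N <= n)%N -> k ^+ n * c < e.
Proof.
move=> /andP[k0 k1] e0.
have kn : `|k| < 1 by rewrite ger0_norm.
have d0 : 0 < e / (`|c| + 1) by rewrite divr_gt0 // ltr_wpDl.
have /cvgrPdist_lt /(_ _ d0) [N _ hN] := cvg_expr kn.
exists N => n Nn; have := hN n Nn; rewrite /= sub0r normrN ltr_pdivlMr ?ltr_wpDl //.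
apply: le_lt_trans; rewrite (le_trans (ler_norm _)) // normrM ler_wpM2l //.
by rewrite lerDl.
Qed.

(** Neumann iteration: u_{n+1} = y + T u_n from u_0 = 0 has increments of size at most k^n ||y||,
    and its limit solves x - T x = y. *)
Lemma contraction_invertible T (k : R) : linear_op T -> 0 <= k < 1 ->
  (forall x, hnorm (T x) <= k * hnorm x) -> invertible (fun x => x - T x).
Proof.
move=> lT k01 hT; have /andP[k0 k1] := k01.
have k1' : 0 < 1 - k by rewrite subr_gt0.
have below x : (1 - k) * hnorm x <= hnorm (x - T x).
  have := hnormD (x - T x) (T x); rewrite subrK; have := hT x; lra.
have lD : linear_op (fun x => x - T x) by exact: linear_op_sub linear_op_id lT.
apply: (bounded_below_invertible lD k1' below).
move=> y; pose u n := iter n (fun x => y + T x) 0.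
have step n : hnorm (u n.+1 - u n) <= k ^+ n * hnorm y.
  elim: n => [|n IH]; first by rewrite /u /= linear_op0 // addr0 subr0 mul1r.
  have -> : u n.+2 - u n.+1 = T (u n.+1 - u n).
    by rewrite linear_opB // /u /= opprD addrACA subrr add0r.
  by rewrite (le_trans (hT _)) // exprS -mulrA ler_wpM2l.
(* The defect of [u n] as a solution is its next increment. With [below], the distance of two
   iterates is controlled by two increments, so no geometric series is summed. *)
have stepE n : u n - T (u n) = y - (u n.+1 - u n).
  by rewrite /u /= !opprD opprK !addrA subrr add0r addrC.
have cauchy (e : R) : 0 < e -> exists N, forall m n, (N <= m)%N -> (N <= n)%N ->
    hnorm (u m - u n) < e.
  move=> e0; have [|N hN] := @expr_small k (hnorm y) (e * (1 - k) / 2) k01.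
    by rewrite divr_gt0 // mulr_gt0.
  exists N => m n Nm Nn; rewrite -(ltr_pM2l k1').
  apply: le_lt_trans (below _) _.
  have sub2l a b : (y - a) - (y - b) = - a + b.
    by rewrite opprB addrAC [y + _]addrC subrK addrC.
  rewrite (linear_opB lD) !stepE sub2l.
  apply: le_lt_trans (hnormD _ _) _; rewrite hnormN.
  have := hN m Nm; have := hN n Nn; have := step m; have := step n; lra.
have [x hx] := hcomplete cauchy; exists x.
apply/eqP; rewrite -subr_eq0 -hnorm_eq0 eq_le hnorm_ge0 andbT.
apply/ler_addgt0Pr => e e0; rewrite add0r.
have [|N hN] := @expr_small k (hnorm y) (e / 2) k01; first exact: divr_gt0.
have [|N' hN'] := hx (e / 4); first exact: divr_gt0.
pose n := maxn N N'; have {}hN := hN n (leq_maxl _ _).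
have {}hN' : hnorm (u n - x) < e / 4 := hN' n (leq_maxr _ _).
have -> : x - T x - y = - (u n - x - T (u n - x)) + - (u n.+1 - u n).
  have eD : u n - T (u n) + (u n.+1 - u n) = y by rewrite stepE subrK.
  transitivity (x - T x - (u n - T (u n) + (u n.+1 - u n))); first by rewrite eD.
  by rewrite (linear_opB lD) opprD addrA; congr (_ - _); rewrite [RHS]opprB.
apply: le_trans (hnormD _ _) _; rewrite !hnormN.
have := hnormB (u n - x) (T (u n - x)); have := hT (u n - x); have := step n.
have : k * hnorm (u n - x) <= hnorm (u n - x) by rewrite ler_piMl ?hnorm_ge0 // ltW.
lra.
Qed.

(** Lax-Milgram: ||x - t B x||^2 <= (1 - 2 t d + t^2 N^2) ||x||^2, and t = d / N^2 makes the factor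
    1 - d t, so that I - t B is a contraction. *)
Lemma coercive_invertible B (d : R) : bounded_op B -> 0 < d ->
  (forall x, d * hnorm x ^+ 2 <= Re (inner (B x) x)) -> invertible B.
Proof.
move=> bB d0 hd; have [M M0 hM] := bounded_op_gt0 bB.
(* Enlarging the bound M by d ensures d < N, hence d t = (d / N)^2 < 1. *)
pose N := M + d; have N0 : 0 < N by rewrite addr_gt0.
pose t := d / N ^+ 2; have t0 : 0 < t by rewrite divr_gt0 // exprn_gt0.
apply: (@invertible_scale t%:C); first by rewrite -cmod_eq0 cmod_real normr_eq0 gt_eqF.
have -> : (fun x => t%:C *: B x) = (fun x => x - (x - t%:C *: B x)).
  by apply/funext => x; rewrite opprB addrC subrK.
have dN : d * t < 1.
  rewrite /t mulrA ltr_pdivrMr ?exprn_gt0 // mul1r -expr2 ltr_pXn2r ?nnegrE ?ltW //.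
  by rewrite ltrDr.
have dN0 : 0 < d * t by exact: mulr_gt0.
apply: (@contraction_invertible _ (Num.sqrt (1 - d * t))).
- exact: linear_op_sub linear_op_id (linear_op_scale _ bB.1).
- by rewrite sqrtr_ge0 -[ltRHS]sqrtr1 ltr_sqrt //; lra.
move=> x; rewrite -(@ler_pXn2r _ 2) ?nnegrE ?mulr_ge0 ?hnorm_ge0 ?sqrtr_ge0 //.
have sk : Num.sqrt (1 - d * t) ^+ 2 = 1 - d * t by rewrite sqr_sqrtr //; lra.
rewrite exprMn sk.
rewrite sqr_hnormB hnormZ innerZr.
rewrite conjc_real ReMl cmod_real ger0_norm ?(ltW t0) //.
have -> : Re (inner x (B x)) = Re (inner (B x) x) by rewrite inner_conj ReJ.
have hB : hnorm (B x) ^+ 2 <= N ^+ 2 * hnorm x ^+ 2.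
  rewrite -exprMn ler_pXn2r ?nnegrE ?mulr_ge0 ?hnorm_ge0 ?(ltW N0) //.
  by rewrite (le_trans (hM x)) // ler_wpM2r ?hnorm_ge0 // lerDl ltW.
have tB : (t * hnorm (B x)) ^+ 2 <= d * t * hnorm x ^+ 2.
  rewrite exprMn (le_trans (ler_wpM2l (sqr_ge0 t) hB)) // mulrA.
  apply: ler_wpM2r; first exact: sqr_ge0.
  suff -> : t ^+ 2 * N ^+ 2 = d * t by [].
  by rewrite /t; field; rewrite gt_eqF.
have := ler_wpM2l (ltW t0) (hd x); rewrite mulrA (mulrC t); lra.
Qed.

End Operators.

(** * The operator norm as a supremum over the unit ball *)

Section OperatorNorm.
Variables (R : realType) (H : hilbert R).
Implicit Types (A B P Q T : H -> H) (x y : H).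

Lemma opnorm_ub T x : bounded_op T -> hnorm (T x) <= opnorm T * hnorm x.
Proof.
move=> bT; have [M M0 hM] := bounded_op_gt0 bT.
have [->|x0] := eqVneq x 0; first by rewrite (linear_op0 bT.1) hnorm0 mulr0.
have nx : 0 < hnorm x by rewrite lt_def hnorm_ge0 hnorm_eq0 x0.
rewrite -ler_pdivrMr //; apply: ub_le_sup.
  exists M => _ [y [y1 ->]]; apply: le_trans (hM y) _.
  by rewrite -[leRHS]mulr1 ler_wpM2l // ltW.
exists ((hnorm x)^-1%:C *: x); rewrite (linear_opZ bT.1) !hnormZ cmod_real.
by rewrite ger0_norm ?invr_ge0 ?hnorm_ge0 // mulVf ?gt_eqF // mulrC lexx.
Qed.

Lemma opnorm_ge0 T : bounded_op T -> 0 <= opnorm T.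
Proof.
move=> bT; have [M M0 hM] := bounded_op_gt0 bT.
apply: (@le_trans _ _ (hnorm (T 0))); first exact: hnorm_ge0.
apply: ub_le_sup; last by exists 0; rewrite hnorm0 ler01.
exists M => _ [y [y1 ->]]; apply: le_trans (hM y) _.
by rewrite -[leRHS]mulr1 ler_wpM2l // ltW.
Qed.

Lemma opnorm_le T (c : R) : 0 <= c -> (forall x, hnorm (T x) <= c * hnorm x) ->
  opnorm T <= c.
Proof.
move=> c0 hT; apply: ge_sup; first by exists (hnorm (T 0)), 0; rewrite hnorm0 ler01.
move=> _ [x [x1 ->]]; apply: le_trans (hT x) _.
by rewrite -[leRHS]mulr1 ler_wpM2l.
Qed.

Lemma opnorm_gt0 T x : bounded_op T -> T x != 0 -> 0 < opnorm T.
Proof.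
move=> bT Tx0; rewrite lt_def opnorm_ge0 // andbT; apply: contra Tx0 => /eqP T0.
by have := opnorm_ub x bT; rewrite T0 mul0r -hnorm_eq0 eq_le hnorm_ge0 andbT.
Qed.

End OperatorNorm.

(** * Numerical radius and the power inequality *)

Section NumericalRadius.
Variables (R : realType) (H : hilbert R).
Implicit Types (A Q T : H -> H) (x y : H).

Definition numrad_le T (c : R) :=
  forall x, cmod (inner (T x) x) <= c * hnorm x ^+ 2.

(** Polarisation: the symmetrised form [s] is a difference of two values of the quadratic form,
    bounded through the parallelogram law; (T u, v) is then recovered from [s u v] and
    [s u (i v)]. *)
Lemma numrad_le_norm T c x : linear_op T -> numrad_le T c ->
  hnorm (T x) <= 2 * c * hnorm x.
Proof.
move=> lT hT.
pose s u v := inner (T u) v + inner (T v) u.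
have sE u v : 2 * s u v
    = inner (T (u + v)) (u + v) - inner (T (u - v)) (u - v).
  by rewrite (linear_opD lT) (linear_opB lT) !innerDl !innerDr !innerNl !innerNr /s; ring.
have s_le u v : cmod (s u v) <= c * (hnorm u ^+ 2 + hnorm v ^+ 2).
  have : cmod (2 * s u v) <= c * hnorm (u + v) ^+ 2 + c * hnorm (u - v) ^+ 2.
    rewrite sE (le_trans (cmodD _ _)) // cmodN lerD //; exact: hT.
  rewrite cmodM -[2]/(2%:R) -(rmorph_nat (real_complex R)) cmod_real ger0_norm //.
  rewrite sqr_hnormD sqr_hnormB; lra.
have polar u v : 2 * inner (T u) v = s u v + 'i%C * s u ('i%C *: v).
  have ii : 'i%C * 'i%C = -1 :> R[i] by rewrite -expr2 sqr_i.
  have ci : ('i%C)^*%C = - 'i%C :> R[i] by rewrite /conjc; simpc.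
  by rewrite /s (linear_opZ lT) innerZl innerZr ci; ring: ii.
have T_le u v : cmod (inner (T u) v) <= c * (hnorm u ^+ 2 + hnorm v ^+ 2).
  have : cmod (2 * inner (T u) v)
       <= c * (hnorm u ^+ 2 + hnorm v ^+ 2) + c * (hnorm u ^+ 2 + hnorm v ^+ 2).
    have ci : cmod ('i%C : R[i]) = 1 by rewrite /cmod /= expr0n add0r expr1n sqrtr1.
    rewrite polar (le_trans (cmodD _ _)) // lerD // cmodM ci mul1r.
    by rewrite (le_trans (s_le _ _)) // hnormZ ci mul1r.
  rewrite cmodM -[2]/(2%:R) -(rmorph_nat (real_complex R)) cmod_real ger0_norm //; lra.
have [->|x0] := eqVneq x 0; first by rewrite linear_op0 // hnorm0 mulr0.
have nx : 0 < hnorm x by rewrite lt_def hnorm_ge0 hnorm_eq0 x0.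
have [Tx0|Tx0] := eqVneq (T x) 0.
  (* Testing against 0 yields 0 <= c ||x||^2, hence c >= 0. *)
  have := T_le x 0; rewrite inner0r cmod0 hnorm0 expr0n addr0 pmulr_lge0 ?exprn_gt0 //.
  by move=> c0; rewrite Tx0 hnorm0 !mulr_ge0 // ltW.
have nTx : 0 < hnorm (T x) by rewrite lt_def hnorm_ge0 hnorm_eq0 Tx0.
(* The test vector is T x rescaled to length ||x||, so the estimate reads ||x|| ||T x|| <= 2 c
   ||x||^2. *)
have := T_le x ((hnorm x / hnorm (T x))%:C *: T x).
rewrite innerZr conjc_real cmodM inner_self hnormZ !cmod_real.
have r0 : 0 <= hnorm x / hnorm (T x) by rewrite divr_ge0 // hnorm_ge0.
rewrite (ger0_norm r0) ger0_norm ?sqr_ge0 // divfK ?gt_eqF // => h.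
rewrite -(ler_pM2l nx); apply: le_trans (le_trans _ h) _.
  by rewrite le_eqVlt; apply/orP; left; apply/eqP; field; rewrite gt_eqF.
by rewrite le_eqVlt; apply/orP; left; apply/eqP; ring.
Qed.

(* Pearcy's proof of the power inequality: with x1 = c x + S x and
   x2 = c x - S x, both c x1 - S x1 and c x2 + S x2 equal c^2 x - S^2 x. *)
Lemma numrad_le_sqr T (c : R) : linear_op T -> 0 < c -> numrad_le T c ->
  numrad_le (T \o T) (c ^+ 2).
Proof.
move=> lT c0 hT x; have [u u1 <-] := cmod_Re (inner ((T \o T) x) x).
(* A square root of the rotation u is absorbed into S = v T, since S^2 = u T^2 while S keeps the
   bound c. *)
pose v := sqrtc u; have vv : v * v = u by rewrite -expr2 sqr_sqrtc.
have v1 : cmod v = 1.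
  have : cmod v ^+ 2 = 1 by rewrite expr2 -cmodM vv.
  by move/eqP; rewrite sqrp_eq1 ?cmod_ge0 // => /eqP.
pose S y := v *: T y; have lS : linear_op S by exact: linear_op_scale.
have S_le y : `|Re (inner (S y) y)| <= c * hnorm y ^+ 2.
  by rewrite (le_trans (Re_le_cmod _)) // innerZl cmodM v1 mul1r.
pose x1 := c%:C *: x + S x; pose x2 := c%:C *: x - S x.
have e1 : c%:C *: x1 - S x1 = (c ^+ 2)%:C *: x - S (S x).
  rewrite /x1 (linear_opD lS) (linear_opZ lS) scalerDr scalerA -rmorphM /= -expr2.
  by rewrite opprD addrA addrK.
have e2 : c%:C *: x2 + S x2 = (c ^+ 2)%:C *: x - S (S x).
  rewrite /x2 (linear_opB lS) (linear_opZ lS) scalerBr scalerA -rmorphM /= -expr2.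
  by rewrite addrA subrK.
(* This real part is c ||x1||^2 - Re (S x1, x1). Adding [h2] pairs c^2 x - S^2 x with x1 + x2 = 2 c
   x, which gives Re (S^2 x, x) <= c^2 ||x||^2. *)
have h1 : 0 <= Re (inner ((c ^+ 2)%:C *: x - S (S x)) x1).
  rewrite -e1 innerBl innerZl ReB ReMl inner_self /= subr_ge0.
  exact: le_trans (ler_norm _) (S_le _).
have h2 : 0 <= Re (inner ((c ^+ 2)%:C *: x - S (S x)) x2).
  rewrite -e2 innerDl innerZl ReD ReMl inner_self /= -[Re _]opprK subr_ge0.
  by apply: le_trans (ler_norm _) _; rewrite normrN.
have : 0 <= Re (inner ((c ^+ 2)%:C *: x - S (S x)) (x1 + x2)).
  by rewrite innerDr ReD addr_ge0.
have -> : x1 + x2 = (2 * c)%:C *: x.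
  by rewrite /x1 /x2 addrACA subrr addr0 -scalerDl -rmorphD /=; congr (_%:C *: _); ring.
rewrite innerZr conjc_real ReMl pmulr_rge0 ?mulr_gt0 //.
rewrite innerBl innerZl ReB ReMl inner_self /= subr_ge0.
by rewrite /S (linear_opZ lT) scalerA vv innerZl.
Qed.

(** * Norm and numerical radius of the inverse of a normal operator *)

(** Normality is recorded on [A], because the adjoint of I - q P is explicit; properties of [Q] are
    then read off by cancellation. *)
Definition normal_inverse A Q :=
  [/\ linear_op A, normal_op A, linear_op Q, cancel A Q & cancel Q A].

Lemma normal_inverse_sqr A Q :
  normal_inverse A Q -> normal_inverse (A \o A) (Q \o Q).
Proof.
move=> [lA [As [adj comm]] lQ AK QK]; split; try exact: linear_op_comp.
- exists (As \o As); split=> [x y|x] /=; first by rewrite !adj.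
  by rewrite !comm.
- by move=> x /=; rewrite AK AK.
- by move=> x /=; rewrite QK QK.
Qed.

(** With z = Q (Q x) the claim is ||A z||^2 <= ||A (A z)|| ||z||. It follows from (A z, A z) = (z,
    As (A z)) and ||As u|| = ||A u||. *)
Lemma normal_inverse_paranormal A Q x : normal_inverse A Q ->
  hnorm (Q x) ^+ 2 <= hnorm x * hnorm (Q (Q x)).
Proof.
move=> [lA [As [adj comm]] lQ AK QK].
have adj' u v : inner (As u) v = inner u (A v).
  by rewrite inner_conj -adj -inner_conj.
have nAs u : hnorm (As u) = hnorm (A u).
  by rewrite /hnorm adj' comm -adj.
set z := Q (Q x); have -> : Q x = A z by rewrite QK.
have -> : hnorm x = hnorm (A (A z)) by rewrite !QK.
rewrite sqr_hnorm adj -nAs inner_conj ReJ; exact: Re_inner_le.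
Qed.

(** The induction passes to A^2, Q^2 and c^2. The factor 2 enters only at k = 0 and does not grow,
    so 2^k-th roots will remove it. *)
Lemma normal_inverse_pow2_bound k A Q (c : R) x :
  normal_inverse A Q -> 0 < c -> numrad_le Q c ->
  hnorm (Q x) ^+ (2 ^ k) <= 2 * (c * hnorm x) ^+ (2 ^ k).
Proof.
elim: k A Q c => [|k IH] A Q c nQ c0 hQ.
  by rewrite !expr1 mulrA; apply: numrad_le_norm => //; case: nQ.
rewrite expnS !exprM.
have := IH _ _ _ (normal_inverse_sqr nQ) (exprn_gt0 2 c0)
  (numrad_le_sqr (let: And5 _ _ lQ _ _ := nQ in lQ) c0 hQ) => /= h.
have hx : 0 <= hnorm x ^+ (2 ^ k) by rewrite exprn_ge0 ?hnorm_ge0.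
apply: le_trans (le_trans _ (ler_wpM2l hx h)) _.
  rewrite -exprMn ler_pXn2r ?nnegrE ?sqr_ge0 ?mulr_ge0 ?hnorm_ge0 ?expn_gt0 //.
  exact: normal_inverse_paranormal nQ.
rewrite mulrCA -exprMn.
suff -> : hnorm x * (c ^+ 2 * hnorm x) = (c * hnorm x) ^+ 2 by [].
by ring.
Qed.

Lemma normal_inverse_numrad A Q (c : R) x :
  normal_inverse A Q -> 0 < c -> numrad_le Q c -> hnorm (Q x) <= c * hnorm x.
Proof.
move=> nQ c0 hQ; rewrite leNgt; apply/negP => lt_cQ.
have cx0 : 0 <= c * hnorm x by rewrite mulr_ge0 ?hnorm_ge0 // ltW.
have Q0 := le_lt_trans cx0 lt_cQ.
have k01 : 0 <= c * hnorm x / hnorm (Q x) < 1.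
  by rewrite divr_ge0 ?hnorm_ge0 //= ltr_pdivrMr // mul1r.
(* If ||Q x|| exceeded c ||x||, the ratio k < 1 would satisfy 2 k^(2^N) < 1 for large N, against the
   previous bound. *)
have [N hN] := @expr_small _ _ 2 1 k01 ltr01.
have := hN (2 ^ N)%N (ltnW (ltn_expl _ _)) => /(_ isT).
rewrite expr_div_n mulrAC ltr_pdivrMr ?exprn_gt0 // mul1r mulrC ltNge.
by rewrite (normal_inverse_pow2_bound N x nQ c0 hQ).
Qed.

(** Bolzano-Weierstrass, from compactness of the square [-M, M]^2. *)
Lemma complex_cluster_point (z : nat -> R[i]) (M : R) :
  (forall n, cmod (z n) <= M) ->
  exists mu, forall (e : R) N, 0 < e -> exists2 n, (N <= n)%N & cmod (z n - mu) < e.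
Proof.
move=> zM; pose u n : R * R := (Re (z n), Im (z n)).
have bnd (r : R) n : `|r| <= cmod (z n) -> (`[- M, M]%classic) r.
  by move=> h; rewrite /= in_itv /= -ler_norml (le_trans h).
have cpt := compact_setX (@segment_compact R (- M) M) (@segment_compact R (- M) M).
have [|[a b] [_ cl]] := cpt (u @ \oo)%classic _.
  exists 0%N => // n _; split; apply: bnd; [exact: Re_le_cmod|exact: Im_le_cmod].
exists (a +i* b) => e N e0.
have e20 : 0 < e / 2 by rewrite divr_gt0.
have [||_ /= [[n Nn <-] [/= ha hb]]] :=
  cl (u @` [set n | (N <= n)%N])%classic (ball (a, b) (e / 2)).
- by exists N => // n /= Nn; exists n.
- exact: nbhsx_ballx.
exists n => //.
have -> : z n - (a +i* b) = (Re (z n) - a)%:C + 'i%C * (Im (z n) - b)%:C.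
  by case: (z n) => p q; simpc.
apply: le_lt_trans (cmodD _ _) _; rewrite cmodM !cmod_real.
have -> : cmod ('i%C : R[i]) = 1 by rewrite /cmod /= expr0n add0r expr1n sqrtr1.
by rewrite mul1r (splitr e) ltrD // distrC.
Qed.

Lemma normal_inverse_approx_eigenvalue A Q :
  normal_inverse A Q -> bounded_op Q -> 0 < opnorm Q ->
  exists2 mu, cmod mu = opnorm Q &
    forall e : R, 0 < e -> exists2 x, hnorm x = 1 & hnorm (Q x - mu *: x) < e.
Proof.
move=> nQ bQ; set m := opnorm Q => m0.
(* Otherwise, by homogeneity, c bounds the numerical radius of [Q] and hence its norm m. *)
have near_m (c : R) : 0 < c < m -> exists x, hnorm x = 1 /\ c < cmod (inner (Q x) x).
  move=> /andP[c0 cm]; apply: contrapT => /forallNP hc.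
  suff : m <= c by rewrite leNgt cm.
  apply: opnorm_le => [|x]; first exact: ltW.
  apply: (normal_inverse_numrad _ nQ c0) => {}x.
  have [->|x0] := eqVneq x 0; first by rewrite inner0r cmod0 hnorm0 expr0n mulr0.
  have nx : 0 < hnorm x by rewrite lt_def hnorm_ge0 hnorm_eq0 x0.
  rewrite leNgt; apply/negP => h; apply: (hc ((hnorm x)^-1%:C *: x)).
  have ix0 : 0 <= (hnorm x)^-1 by rewrite invr_ge0 hnorm_ge0.
  rewrite hnormZ cmod_real ger0_norm // mulVf ?gt_eqF //; split=> //.
  rewrite (linear_opZ bQ.1) innerZl innerZr conjc_real !cmodM !cmod_real !ger0_norm //.
  by rewrite mulrA -invfM -expr2 mulrC ltr_pdivlMr // exprn_gt0.
(* The shift to n + 2 keeps the threshold m (1 - 1/(n + 2)) strictly positive, as [near_m]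
   requires. *)
have /choice[x hx] (n : nat) :
    exists x, hnorm x = 1 /\ m * (1 - n.+2%:R^-1) < cmod (inner (Q x) x).
  apply: near_m; rewrite pmulr_rgt0 // subr_gt0 invf_lt1 ?ltr0n // ltr1n /=.
  by rewrite -[ltRHS]mulr1 ltr_pM2l // ltrBlDr ltrDl invr_gt0 ltr0n.
have Qx n : hnorm (Q (x n)) <= m.
  by have := opnorm_ub (x n) bQ; rewrite (hx n).1 mulr1.
have zm n : cmod (inner (Q (x n)) (x n)) <= m.
  by apply: le_trans (cauchy_schwarz _ _) _; rewrite (hx n).1 mulr1.
have [mu hmu] := complex_cluster_point zm.
have close (e : R) : 0 < e -> exists n,
    cmod (inner (Q (x n)) (x n) - mu) < e /\ m - e < cmod (inner (Q (x n)) (x n)).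
  move=> e0; have [N hN] : exists N : nat, m / e < N%:R.
    by exists (Num.Def.truncn (m / e)).+1; rewrite truncnS_gt.
  have [n Nn hn] := hmu e N e0; exists n; split => //.
  apply: le_lt_trans (hx n).2; rewrite mulrBr mulr1 lerD2l lerN2.
  rewrite ler_pdivrMr ?ltr0n // mulrC -ler_pdivrMr //.
  by apply: le_trans (ltW hN) _; rewrite ler_nat (leq_trans Nn) // -addn2 leq_addr.
have mu_m : cmod mu = m.
  apply/eqP; rewrite eq_le; apply/andP; split; apply/ler_addgt0Pr => e e0.
    have [n [h1 h2]] := close e e0; have := zm n.
    have := cmodD (inner (Q (x n)) (x n)) (mu - inner (Q (x n)) (x n)).
    rewrite addrC subrK -[cmod (mu - _)]cmodN opprB; lra.
  have [|n [h1 h2]] := close (e / 2); first by rewrite divr_gt0.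
  have := cmodD mu (inner (Q (x n)) (x n) - mu); rewrite addrC subrK; lra.
exists mu => // e e0.
(* With z = (Q x, x), ||x|| = 1 and ||Q x|| <= m = |mu|, expansion gives ||Q x - mu x||^2 <= 2 m |z
   - mu|, which this tolerance keeps below e^2. *)
have [|n [h1 h2]] := close (e ^+ 2 / (2 * m + 1)).
  by rewrite divr_gt0 ?exprn_gt0 // ltr_wpDl // mulr_ge0 // ltW.
exists (x n); first exact: (hx n).1.
rewrite -(@ltr_pXn2r _ 2) ?nnegrE ?hnorm_ge0 ?(ltW e0) //.
rewrite sqr_hnormB hnormZ (hx n).1 mulr1 innerZr mu_m.
set z := inner _ _ in h1 h2 *.
have -> : mu^*%C * z = (m ^+ 2)%:C + mu^*%C * (z - mu).
  by rewrite mulrBr [_ * mu]mulrC mulcJ mu_m addrC subrK.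
rewrite ReD /=.
have hRe : - Re (mu^*%C * (z - mu)) <= m * cmod (z - mu).
  by rewrite -mu_m -[cmod mu]cmodJ -cmodM -ReN (le_trans (ler_norm _)) // ReN normrN Re_le_cmod.
have hQ2 : hnorm (Q (x n)) ^+ 2 <= m ^+ 2.
  by rewrite ler_pXn2r ?nnegrE ?hnorm_ge0 ?(ltW m0).
have hd : (2 * m) * cmod (z - mu) < e ^+ 2.
  apply: (@le_lt_trans _ _ (2 * m * (e ^+ 2 / (2 * m + 1)))).
    by rewrite ler_wpM2l ?mulr_ge0 ?(ltW m0) // ltW.
  rewrite mulrA ltr_pdivrMr; last by rewrite ltr_wpDl // mulr_ge0 // ltW.
  by have := exprn_gt0 2 e0; rewrite mulrC mulrDr mulr1 ltrDl.
lra.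
Qed.

End NumericalRadius.

(** * Location of the spectrum and norm of the resolvent *)

Section Spectrum.
Variables (R : realType) (H : hilbert R).
Implicit Types (A B P Q T : H -> H) (x y : H) (l q : R[i]).

Lemma inner_ext x y : (forall u, inner u x = inner u y) -> x = y.
Proof.
move=> h; apply/eqP; rewrite -subr_eq0; apply/eqP/inner_eq0.
by rewrite innerBr h subrr.
Qed.

Lemma adjoint_linear P Ps : (forall x y, inner (P x) y = inner x (Ps y)) ->
  linear_op Ps.
Proof.
move=> adj a x y; apply: inner_ext => u.
by rewrite -adj !innerDr !innerZr !adj.
Qed.

Lemma linear_op_IqP q P : linear_op P -> linear_op (IqP q P).
Proof.
move=> lP; exact: linear_op_sub (@linear_op_id _ _) (linear_op_scale _ lP).
Qed.

Lemma normal_op_IqP q P : linear_op P -> normal_op P -> normal_op (IqP q P).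
Proof.
move=> lP [Ps [adj comm]]; have lPs := adjoint_linear adj.
exists (fun x => x - q^*%C *: Ps x); split=> [x y|x]; rewrite /IqP.
  by rewrite innerBl innerBr innerZl innerZr conjcK adj.
rewrite (linear_opB lP) (linear_opZ lP) (linear_opB lPs) (linear_opZ lPs) comm.
rewrite !scalerBr !opprB !scalerA mulrC -!addrA; congr (_ + _).
by rewrite addrCA [RHS]addrC -addrA; congr (_ + _); rewrite addrC.
Qed.

(** On the zero space the identity inverts every map. A nonzero vector later makes the norm of the
    resolvent positive. *)
Lemma not_invertible_neq0 P : ~ invertible P -> exists x : H, x != 0.
Proof.
move=> nP; apply: contrapT => /forallNP h0.
have triv x : x = 0 by apply/eqP/negPn/negP/h0.
apply: nP; exists id; split; first exact: bounded_op_id.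
by split=> x; rewrite (triv x) ?(triv (P 0)).
Qed.

Lemma invertible_scaler (a : R[i]) A : a != 0 ->
  invertible A -> invertible (fun x => a *: A x).
Proof.
move=> a0 iA; apply: (@invertible_scale _ _ a^-1); first by rewrite invr_eq0.
suff -> : (fun x => a^-1 *: (a *: A x)) = A by [].
by apply/funext => x; rewrite scalerA mulVf // scale1r.
Qed.

Lemma IqP_invertible_small q P : bounded_op P -> cmod q * opnorm P < 1 ->
  invertible (IqP q P).
Proof.
move=> bP qP; apply: (@contraction_invertible _ _ _ (cmod q * opnorm P)).
- exact: linear_op_scale bP.1.
- by rewrite qP mulr_ge0 ?cmod_ge0 ?opnorm_ge0.
- by move=> x; rewrite hnormZ -mulrA ler_wpM2l ?cmod_ge0 ?opnorm_ub.
Qed.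

Lemma IqP_scale q P x : q != 0 -> IqP q P x = q *: (q^-1 *: x - P x).
Proof. by move=> q0; rewrite scalerBr scalerA mulfV // scale1r. Qed.

(** For |l| > ||P||, write l - P = l (I - l^-1 P) and apply the Neumann criterion. *)
Lemma spectrum_le_opnorm P l : bounded_op P -> spectrum P l -> cmod l <= opnorm P.
Proof.
move=> bP sl; rewrite leNgt; apply/negP => ltl; apply: sl.
have l0 : l != 0.
  by rewrite -cmod_eq0 gt_eqF // (le_lt_trans _ ltl) // opnorm_ge0.
have cl0 : 0 < cmod l by rewrite lt_def cmod_ge0 cmod_eq0 l0.
have -> : (fun x => l *: x - P x) = (fun x => l *: IqP l^-1 P x).
  by apply/funext => x; rewrite scalerBr scalerA mulfV // scale1r.
apply: invertible_scaler => //; apply: IqP_invertible_small => //.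
by rewrite cmodV mulrC ltr_pdivrMr // mul1r.
Qed.

Lemma IqP_invertible_spectrum q P : q != 0 -> ~ spectrum P q^-1 ->
  invertible (IqP q P).
Proof.
move=> q0 /contrapT /(invertible_scaler q0); congr (invertible _).
by apply/funext => x; rewrite IqP_scale.
Qed.

(** Off [0, +oo), a scalar multiple of l - P is coercive: the factor -1 gives the constant -Re l
    when l < 0, and the factor -i Im l gives (Im l)^2 when l is not real. *)
Lemma nonneg_selfadjoint_spectrum P l : bounded_op P -> nonneg_selfadjoint P ->
  spectrum P l -> exists2 t : R, 0 <= t & l = t%:C.
Proof.
move=> bP [_ P0] sl; apply: contrapT => hl; apply: sl.
have bl : bounded_op (fun x => l *: x - P x).
  exact: bounded_op_sub (bounded_op_scale _ (@bounded_op_id _ _)) bP.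
have lPE x : exists2 p : R, 0 <= p &
    inner (l *: x - P x) x = l * (hnorm x ^+ 2)%:C - p%:C.
  have := P0 x; rewrite innerBl innerZl inner_self.
  case: (inner (P x) x) => p p'; rewrite lecE /= => /andP[/eqP -> p0].
  by exists p.
have [Im0|Im0] := eqVneq (Im l) 0.
  have Re0 : Re l < 0.
    rewrite ltNge; apply/negP => Re0; apply: hl; exists (Re l) => //.
    by case: l Im0 {bl lPE Re0} => a b /= ->.
  apply: (@invertible_scale _ _ (-1)); first by rewrite oppr_eq0 oner_eq0.
  apply: (@coercive_invertible _ _ _ (- Re l)); rewrite ?oppr_gt0 //.
    exact: bounded_op_scale.
  move=> x; rewrite innerZl; have [p p0 ->] := lPE x.
  by rewrite mulN1r ReN ReB [l * _]mulrC ReMl /=; lra.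
have a0 : (0 -i* Im l) != 0 by rewrite eq_complex /= negb_and oppr_eq0 Im0 orbT.
apply: (invertible_scale a0).
apply: (@coercive_invertible _ _ _ (Im l ^+ 2)).
- exact: bounded_op_scale.
- by rewrite lt_def sqr_ge0 expf_eq0 /= Im0.
- move=> x; rewrite innerZl; have [p p0 ->] := lPE x.
  by case: (l) => a b /=; rewrite le_eqVlt; apply/orP; left; apply/eqP; ring.
Qed.

Lemma opnorm_id (T : H -> H) x : T =1 id -> x != 0 -> opnorm T = 1.
Proof.
move=> Tid x0; have bT : bounded_op T.
  by have -> : T = id by [apply/funext]; exact: bounded_op_id.
apply/eqP; rewrite eq_le opnorm_le //=; last by move=> y; rewrite Tid mul1r.
have nx : 0 < hnorm x by rewrite lt_def hnorm_ge0 hnorm_eq0 x0.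
by have := opnorm_ub x bT; rewrite Tid -{1}[hnorm x]mul1r ler_pM2r.
Qed.

(** With A = I - q P and w = 1 - q l, one has q (l - P) = A (I - w Q). If |w| ||Q|| < 1 both factors
    are invertible, so l is not in the spectrum. *)
Lemma resolvent_norm_ge q P Q l : q != 0 -> linear_op P -> is_inverse (IqP q P) Q ->
  spectrum P l -> (cmod (1 - q * l))^-1 <= opnorm Q.
Proof.
move=> q0 lP iQ sl; have [bQ [AQ QA]] := iQ.
(* The inverse of 0 is 0 by convention, so this case reduces to ||Q|| >= 0. *)
have [->|w0] := eqVneq (1 - q * l) 0; first by rewrite cmod0 invr0 opnorm_ge0.
have cw : 0 < cmod (1 - q * l) by rewrite lt_def cmod_ge0 cmod_eq0 w0.
rewrite leNgt; apply/negP => lt1; apply: sl.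
apply: (invertible_scale q0).
have iw : invertible (IqP (1 - q * l) Q).
  apply: IqP_invertible_small => //.
  by rewrite mulrC -ltr_pdivlMr // mul1r.
have := invertible_comp (ex_intro _ Q iQ) iw; congr (invertible _).
have lA := linear_op_IqP q lP.
apply/funext => x; rewrite /= {2}/IqP (linear_opB lA) (linear_opZ lA) AQ /IqP.
by rewrite scalerBl scale1r opprB [LHS]addrC addrA subrK scalerBr scalerA.
Qed.

Lemma normal_resolvent_norm_attained q P Q : q != 0 -> bounded_op P ->
  normal_op P -> (exists x : H, x != 0) -> is_inverse (IqP q P) Q ->
  exists2 l, spectrum P l & opnorm Q = (cmod (1 - q * l))^-1.
Proof.
move=> q0 bP nP [x0 x0_neq0] [bQ [AQ QA]].
have lA := linear_op_IqP q bP.1.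
have nQ : normal_inverse (IqP q P) Q.
  by split=> //; [exact: normal_op_IqP bP.1 nP | exact: bQ.1].
have m0 : 0 < opnorm Q.
  by apply: (@opnorm_gt0 _ _ _ (IqP q P x0)); rewrite ?QA.
have [mu mu_m approx] := normal_inverse_approx_eigenvalue nQ bQ m0.
have mu0 : mu != 0 by rewrite -cmod_eq0 mu_m gt_eqF.
have cq0 : 0 < cmod q by rewrite lt_def cmod_ge0 cmod_eq0 q0.
(* Chosen so that 1 - q l = 1 / mu, which has modulus 1 / ||Q||. *)
pose l := q^-1 * (1 - mu^-1).
have ql : 1 - q * l = mu^-1 by rewrite mulrA mulfV // mul1r subKr.
exists l; last by rewrite ql cmodV invrK mu_m.
(* Were l - P inverted by S, y = Q x would satisfy y - mu x = - mu q (l - P) y, so ||y|| <= K ||y -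
   mu x||. Then ||Q|| = ||mu x|| <= (1 + K) ||y - mu x|| < ||Q|| / 2 by the choice of e. *)
move=> [S [bS [lS Sl]]]; have [M M0 hM] := bounded_op_gt0 bS.
pose K := M / (opnorm Q * cmod q).
have K0 : 0 < K by rewrite divr_gt0 ?mulr_gt0.
pose e := opnorm Q / (2 * (1 + K)).
have e0 : 0 < e by rewrite divr_gt0 // mulr_gt0 // addr_gt0.
have [x x1 hx] := approx e e0.
set y := Q x in hx.
have res : y - mu *: x = - (mu * q) *: (l *: y - P y).
  have -> : x = y - q *: P y by rewrite /y -{1}[x]AQ.
  have cl : mu * q * l = mu - 1 by rewrite /l; field; rewrite q0 mu0.
  rewrite scaleNr !scalerBr !scalerA !opprB cl scalerBl scale1r opprB.
  by rewrite addrCA.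
have y_le : hnorm y <= K * hnorm (y - mu *: x).
  rewrite res hnormZ cmodN cmodM mu_m /K mulrA divfK ?mulf_neq0 ?gt_eqF //.
  by apply: le_trans (hM _); rewrite Sl.
have y_ge : opnorm Q <= hnorm y + hnorm (y - mu *: x).
  have := hnormB y (y - mu *: x); rewrite opprB addrC subrK hnormZ x1 mu_m mulr1.
  by [].
have : K * hnorm (y - mu *: x) < K * e by rewrite ltr_pM2l.
have : (1 + K) * e = opnorm Q / 2.
  by rewrite /e; field; rewrite gt_eqF // addr_gt0.
lra.
Qed.

Lemma normal_resolvent_norm q P Q : bounded_op P -> normal_op P ->
  ~ invertible P -> is_inverse (IqP q P) Q ->
  exists l0, spectrum P l0 /\ opnorm Q = (cmod (1 - q * l0))^-1 /\
    (forall l, spectrum P l -> (cmod (1 - q * l))^-1 <= opnorm Q).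
Proof.
move=> bP nP niP iQ; have [x x0] := not_invertible_neq0 niP.
(* For q = 0 the inverse is the identity, and the maximum is attained at 0, a spectral point because
   P is not invertible. *)
have [q0|q0] := eqVneq q 0.
  have Qid : Q =1 id.
    by move=> y; have := iQ.2.1 y; rewrite /IqP q0 scale0r subr0.
  rewrite (opnorm_id Qid x0); exists 0.
  split; last by rewrite q0; split=> [|l _]; rewrite mul0r subr0 cmod1 invr1.
  move=> h; apply: niP; apply: (@invertible_scale _ _ (-1)).
    by rewrite oppr_eq0 oner_eq0.
  move: h; congr (invertible _).
  by apply/funext => y; rewrite scale0r sub0r scaleN1r.
have [l sl Ql] := normal_resolvent_norm_attained q0 bP nP (ex_intro _ x x0) iQ.
by exists l; split=> //; split=> // l' sl'; exact: resolvent_norm_ge q0 bP.1 iQ sl'.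
Qed.

End Spectrum.

(** * Plane geometry of sectors *)

Section Sectors.
Variable R : realType.
Implicit Types (l q : R[i]) (t s gamma phi psi theta : R).

Lemma cexpiD phi psi : cexpi (phi + psi) = cexpi phi * cexpi psi.
Proof. by rewrite /cexpi cosD sinD [sin phi * _ + _]addrC; simpc. Qed.

Lemma cmod_cexpi phi : cmod (cexpi phi) = 1.
Proof. by rewrite /cmod /= cos2Dsin2 sqrtr1. Qed.

Lemma cmod_polar t psi : 0 <= t -> cmod (t%:C * cexpi psi) = t.
Proof. by move=> t0; rewrite cmodM cmod_cexpi mulr1 cmod_real ger0_norm. Qed.

Lemma sqr_cmod_1D s theta :
  cmod (1 + s%:C * cexpi theta) ^+ 2 = 1 + 2 * s * cos theta + s ^+ 2.
Proof.
rewrite sqr_cmod /=; transitivity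
  (1 + 2 * s * cos theta + s ^+ 2 * (cos theta ^+ 2 + sin theta ^+ 2)); first ring.
by rewrite cos2Dsin2 mulr1.
Qed.

Lemma ler_cos_abs theta phi : `|theta| <= phi -> phi <= pi -> cos phi <= cos theta.
Proof.
move=> h1 h2; have t_in : `|theta| \in `[0, pi].
  by rewrite in_itv /= normr_ge0 (le_trans h1).
have p_in : phi \in `[0, pi] by rewrite in_itv /= h2 (le_trans _ h1).
by rewrite -[cos theta]cos_norm leNgt ltr_cos // -leNgt.
Qed.

Lemma sin_le_cmod_1D s theta (delta : R) : 0 <= delta -> `|theta| <= pi - delta ->
  0 <= s -> sin delta <= cmod (1 + s%:C * cexpi theta).
Proof.
move=> d0 h s0; have [sd|sd] := lerP (sin delta) 0.
  exact: le_trans sd (cmod_ge0 _).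
rewrite -(@ler_pXn2r _ 2) ?nnegrE ?cmod_ge0 ?(ltW sd) // sqr_cmod_1D.
have hpi : pi - delta <= pi by rewrite gerBl.
have := ler_cos_abs h hpi; rewrite cosB cospi sinpi mul0r addr0 mulN1r => hc.
(* The squared modulus is at least 1 - 2 s cos delta + s^2 = (s - cos delta)^2 + sin^2 delta. *)
have := ler_wpM2l s0 hc; have := sqr_ge0 (s - cos delta); rewrite sin2cos2; lra.
Qed.

Lemma cmod_1D_neq0 s theta : 0 <= s -> `|theta| < pi ->
  1 + s%:C * cexpi theta != 0.
Proof.
move=> s0 h; rewrite -cmod_eq0 -sqrf_eq0 sqr_cmod_1D gt_eqF //.
have hc : -1 < cos theta.
  rewrite -cospi -[cos theta]cos_norm ltr_cos // in_itv /= ?lexx ?pi_ge0 //.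
  by rewrite normr_ge0 ltW.
move: s0; rewrite le_eqVlt => /orP[/eqP <-|s0]; first by rewrite mulr0 mul0r; lra.
(* The squared modulus equals (1 - s)^2 + 2 s (1 + cos theta). *)
have : 0 < s * (1 + cos theta) by rewrite mulr_gt0 //; lra.
have := sqr_ge0 (1 - s); lra.
Qed.

Lemma closed_sector_polar gamma l : 0 < gamma < pi / 2 ->
  cclosure (sector gamma) l ->
  exists t psi, [/\ 0 <= t, `|psi| <= gamma & l = t%:C * cexpi psi].
Proof.
move=> /andP[g0 g2] cl.
have cosg : 0 < cos gamma by apply: cos_gt0_pihalf; rewrite g2 andbT; lra.
have sing : 0 < sin gamma by apply: sin_gt0_pihalf; rewrite g0.
have sing1 := sin_le1 gamma; have cosg1 := cos_le1 gamma.
(* The sector satisfies Re >= 0 and sin(gamma -+ phi) >= 0. These are linear in the coordinates, so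
   they survive the closure up to an arbitrary e. *)
have approx (e : R) : 0 < e -> [/\ 0 <= Re l + e,
    Im l * cos gamma <= Re l * sin gamma + e &
    - Im l * cos gamma <= Re l * sin gamma + e].
  move=> e0; have [|w [[rho [phi [rho0 [/andP[p1 p2] ->]]]] hw]] := cl (e / 2).
    by rewrite divr_gt0.
  have := le_lt_trans (Re_le_cmod _) hw; have := le_lt_trans (Im_le_cmod _) hw.
  case: l {cl hw} => a b /=; rewrite !mul0r addr0 subr0.
  rewrite !ltr_norml => /andP[I1 I2] /andP[R1 R2].
  have cosp : 0 <= rho * cos phi.
    by apply: mulr_ge0; [exact: ltW | apply: cos_ge0_pihalf; lra].
  have s1 : 0 <= rho * sin (gamma - phi).
    by apply: mulr_ge0; [exact: ltW | apply: sin_ge0_pi; lra].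
  have s2 : 0 <= rho * sin (gamma + phi).
    by apply: mulr_ge0; [exact: ltW | apply: sin_ge0_pi; lra].
  rewrite sinB in s1; rewrite sinD in s2.
  split; first lra.
    have := ler_wpM2r (ltW cosg) (ltW I2); have := ler_wpM2r (ltW sing) (ltW R1).
    have := ler_wpM2l (ltW e0) sing1; have := ler_wpM2l (ltW e0) cosg1; lra.
  have := ler_wpM2r (ltW cosg) (ltW I1); have := ler_wpM2r (ltW sing) (ltW R1).
  have := ler_wpM2l (ltW e0) sing1; have := ler_wpM2l (ltW e0) cosg1; lra.
have a0 : 0 <= Re l by apply/ler_addgt0Pr => e /approx[].
have b1 : Im l * cos gamma <= Re l * sin gamma by apply/ler_addgt0Pr => e /approx[].
have b2 : - Im l * cos gamma <= Re l * sin gamma by apply/ler_addgt0Pr => e /approx[].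
case: l a0 b1 b2 {cl approx} => a b /= a0 b1 b2.
have [a_eq0|a_neq0] := eqVneq a 0.
  rewrite a_eq0 mul0r in b1 b2.
  exists 0, 0; split; rewrite ?normr0 ?(ltW g0) //.
  have -> : b = 0 by apply: le_anti; rewrite -(pmulr_lle0 _ cosg) b1 -oppr_le0 -(pmulr_lle0 _ cosg).
  by rewrite a_eq0 mul0r.
have a_gt0 : 0 < a by rewrite lt_def a_neq0.
have gin (x : R) : -gamma <= x <= gamma -> x \in `](- (pi / 2)), (pi / 2)[.
  by rewrite in_itv /= => /andP[? ?]; apply/andP; split; lra.
(* Monotonicity of [atan] turns |b / a| <= tan gamma into |psi| <= gamma. *)
pose psi := atan (b / a).
have cpsi : 0 < cos psi by apply: cos_gt0_pihalf; rewrite atan_gtNpi2 atan_ltpi2.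
exists (a / cos psi), psi; split.
- by rewrite divr_ge0 // ltW.
- rewrite ler_norml; apply/andP; split.
    rewrite -[leLHS](tanK (gin _ _)) ?lexx ?andbT; last lra.
    apply: le_atan; rewrite tanN ler_pdivlMr // mulNr lerNl /tan mulrAC.
    by rewrite ler_pdivlMr // [_ * a]mulrC.
  rewrite -[leRHS](tanK (gin _ _)) ?lexx ?andbT; last lra.
  apply: le_atan; rewrite ler_pdivrMr // /tan mulrAC ler_pdivlMr // [_ * a]mulrC //.
- have : sin psi = b / a * cos psi.
    by rewrite -(atanK (b / a)) -/psi /tan divfK // gt_eqF.
  rewrite /cexpi => ->; simpc; congr (_ +i* _); field; rewrite ?gt_eqF //.
Qed.

(** Arguments add: -q = rho e^(i phi) gives theta = phi + psi. The case gamma' = gamma serves (a),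
    the case gamma' > gamma serves (b). *)
Lemma neg_sector_mul q gamma (gamma' : R) t psi : neg_sector (pi - gamma') q ->
  0 <= t -> `|psi| <= gamma ->
  exists s theta, [/\ 0 <= s, `|theta| < pi - (gamma' - gamma) &
    1 - q * (t%:C * cexpi psi) = 1 + s%:C * cexpi theta].
Proof.
move=> [rho [phi [rho0 [/andP[p1 p2] qE]]]] t0; rewrite ler_norml => /andP[g1 g2].
exists (rho * t), (phi + psi); split; first by rewrite mulr_ge0 // ltW.
  by rewrite ltr_norml; apply/andP; split; lra.
by rewrite -mulNr qE cexpiD rmorphM /=; congr (_ + _); ring.
Qed.

Lemma neg_sector_neq0 gamma q : neg_sector gamma q -> q != 0.
Proof.
move=> [rho [phi [rho0 [_ qE]]]]; rewrite -cmod_eq0 -cmodN qE.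
by rewrite cmod_polar ?gt_eqF // ltW.
Qed.

(* Here |1 - q l| dominates both 1 - |q| t >= |q| (p - t) and sin gamma, while
   |p - l| <= (p - t) + t |1 - e^(i psi)| with |1 - e^(i psi)| <= 2 sin gamma. *)
Lemma cmod_1B_le4 q (p : R) t psi gamma : 0 <= t <= p -> `|psi| <= gamma ->
  gamma <= pi / 2 -> cmod q * p < 1 -> sin gamma <= 1 - cmod q * p ->
  cmod (1 - q * p%:C) <= 4 * cmod (1 - q * (t%:C * cexpi psi)).
Proof.
move=> /andP[t0 tp] psig g2 qp sg.
have g0 : 0 <= gamma := le_trans (normr_ge0 _) psig.
have pi0 := pi_gt0 R.
have cosg : 0 <= cos gamma by apply: cos_ge0_pihalf; lra.
have sing : 0 <= sin gamma by apply: sin_ge0_pi; lra.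
have q0 := cmod_ge0 q.
set l := t%:C * cexpi psi; have lt : cmod l = t by exact: cmod_polar.
have qt : cmod q * t <= cmod q * p by rewrite ler_wpM2l.
have low : 1 - cmod q * t <= cmod (1 - q * l).
  have := cmodD (1 - q * l) (q * l); rewrite subrK cmod1 cmodM lt; lra.
have chord : cmod (1 - cexpi psi) <= 2 * sin gamma.
  rewrite -(@ler_pXn2r _ 2) ?nnegrE ?cmod_ge0 ?mulr_ge0 //.
  have cc : cos gamma <= cos psi by apply: ler_cos_abs => //; lra.
  rewrite sqr_cmod /= exprMn sin2cos2.
  have := cos2Dsin2 psi; have := cos_le1 gamma.
  have : 0 <= (1 - cos gamma) * cos gamma by rewrite mulr_ge0 // subr_ge0 cos_le1.
  lra.
have pl : cmod (p%:C - l) <= (p - t) + t * (2 * sin gamma).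
  have -> : p%:C - l = (p - t)%:C + t%:C * (1 - cexpi psi).
    by rewrite /l rmorphB /=; ring.
  apply: le_trans (cmodD _ _) _; rewrite cmodM !cmod_real !ger0_norm ?subr_ge0 //.
  by rewrite lerD2l ler_wpM2l.
have -> : 1 - q * p%:C = (1 - q * l) - q * (p%:C - l) by ring.
apply: le_trans (cmodD _ _) _; rewrite cmodN cmodM.
(* The terms |1 - q l|, |q| (p - t) and 2 |q| t sin gamma are at most 1, 1 and 2 times |1 - q l|. *)
have := ler_wpM2l q0 pl.
have : cmod q * t * 2 * sin gamma <= 2 * sin gamma.
  by rewrite ler_wpM2r //; lra.
lra.
Qed.

End Sectors.

(** * Assembly of the four estimates *)

(** Merges the two alternatives of the hypothesis; in the self-adjoint one the angle is 0. *)
Lemma thm32_spectrum_polar (R : realType) (H : hilbert R) (P : H -> H) (gamma : R) l :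
  thm32_hyp P gamma -> spectrum P l ->
  exists t psi, [/\ 0 <= t <= opnorm P, `|psi| <= gamma & l = t%:C * cexpi psi].
Proof.
move=> [bP [_ [_ hg]]] sl.
suff [t [psi [t0 hpsi lE]]] :
    exists t psi, [/\ 0 <= t, `|psi| <= gamma & l = t%:C * cexpi psi].
  exists t, psi; split=> //; rewrite t0 /=.
  by rewrite -(cmod_polar psi t0) -lE spectrum_le_opnorm.
case: hg => [[g sP]|[-> nP]]; first exact: closed_sector_polar (sP _ sl).
have [t t0 ->] := nonneg_selfadjoint_spectrum bP nP sl.
exists t, 0; split; rewrite ?normr0 //.
by rewrite /cexpi cos0 sin0 mulr1.
Qed.

Lemma thm32_gamma_bounds (R : realType) (H : hilbert R) (P : H -> H) (gamma : R) :
  thm32_hyp P gamma -> 0 <= gamma < pi / 2.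
Proof.
move=> [_ [_ [_ [[/andP[g0 g2] _]|[-> _]]]]]; first by rewrite ltW.
by rewrite lexx divr_gt0 // pi_gt0.
Qed.

(** Common source of (c) and (d): the norm is attained at a spectral point, where the factor 4
    comparison applies. *)
Lemma thm32_norm_bound (R : realType) (H : hilbert R) (P : H -> H) (gamma : R)
    (q : R[i]) (Q : H -> H) :
  thm32_hyp P gamma -> cmod q * opnorm P < 1 ->
  sin gamma <= 1 - cmod q * opnorm P -> is_inverse (IqP q P) Q ->
  opnorm Q <= 4 / cmod (1 - q * (opnorm P)%:C).
Proof.
move=> hyp qP sg iQ; have [bP [nP [niP _]]] := hyp.
have /andP[g0 g2] := thm32_gamma_bounds hyp.
have [l0 [sl0 [-> _]]] := normal_resolvent_norm bP nP niP iQ.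
have [t [psi [tP hpsi ->]]] := thm32_spectrum_polar hyp sl0.
have pos z : cmod z < 1 -> 0 < cmod (1 - z).
  move=> z1; have := cmodD (1 - z) z; rewrite subrK cmod1; lra.
have /andP[t0 tp] := tP.
rewrite ler_pdivlMr; last first.
  by apply: pos; rewrite cmodM cmod_real ger0_norm // opnorm_ge0.
rewrite mulrC ler_pdivrMr; last first.
  apply: pos; rewrite cmodM cmod_polar //.
  by rewrite (le_lt_trans _ qP) // ler_wpM2l // cmod_ge0.
by apply: cmod_1B_le4 hpsi _ qP sg; rewrite // ltW.
Qed.

Theorem theorem3p2 (R : realType) :
  (* (a) *)
  (forall (H : hilbert R) (P : H -> H) (gamma : R), thm32_hyp P gamma ->
   forall q : R[i], neg_sector (pi - gamma) q \/ cmod q * opnorm P < 1 ->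
     invertible (IqP q P) /\
     forall Q, is_inverse (IqP q P) Q ->
       exists l0, spectrum P l0 /\ opnorm Q = (cmod (1 - q * l0))^-1 /\
         (forall l, spectrum P l -> (cmod (1 - q * l))^-1 <= opnorm Q))
  /\
  (* (b) *)
  (forall (H : hilbert R) (P : H -> H) (gamma : R), thm32_hyp P gamma ->
   forall gamma' : R, gamma < gamma' < pi / 2 ->
   forall q : R[i], neg_sector (pi - gamma') q ->
   forall Q, is_inverse (IqP q P) Q -> opnorm Q <= 1 / sin (gamma' - gamma))
  /\
  (* (c) *)
  (forall r : R, 0 < r < 1 -> exists C : R,
   forall (H : hilbert R) (P : H -> H) (gamma : R), thm32_hyp P gamma ->
   0 < sin gamma < 1 - r ->
   forall q : R[i], cmod q * opnorm P < 1 - sin gamma ->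
   forall Q, is_inverse (IqP q P) Q ->
     opnorm Q <= C / cmod (1 - q * (opnorm P)%:C))
  /\
  (* (d) *)
  (forall (H : hilbert R) (P : H -> H) (gamma : R), thm32_hyp P gamma ->
   nonneg_selfadjoint P ->
   forall q : R[i], cmod q * opnorm P < 1 ->
   forall Q, is_inverse (IqP q P) Q ->
     opnorm Q <= 4 / cmod (1 - q * (opnorm P)%:C)).
Proof.
split; last split; last split.
- move=> H P gamma hyp q hq; have [bP [nP [niP _]]] := hyp.
  split; last by move=> Q; exact: normal_resolvent_norm.
  case: hq => [hq|]; last exact: IqP_invertible_small.
  have q0 := neg_sector_neq0 hq.
  (* If 1/q were spectral, 1 - q (1/q) = 0 would have the form 1 + s e^(i theta) with |theta| < pi,
     which never vanishes. *)
  apply: IqP_invertible_spectrum => // sq.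
  have [t [psi [/andP[t0 _] hpsi qE]]] := thm32_spectrum_polar hyp sq.
  have [s [theta [s0 htheta E]]] := neg_sector_mul hq t0 hpsi.
  rewrite subrr subr0 in htheta.
  by have := cmod_1D_neq0 s0 htheta; rewrite -E -qE mulfV // subrr eqxx.
- move=> H P gamma hyp gamma' /andP[gg' g'2] q hq Q iQ.
  have [bP [nP [niP _]]] := hyp; have /andP[g0 _] := thm32_gamma_bounds hyp.
  have [l0 [sl0 [-> _]]] := normal_resolvent_norm bP nP niP iQ.
  have [t [psi [/andP[t0 _] hpsi ->]]] := thm32_spectrum_polar hyp sl0.
  have [s [theta [s0 htheta ->]]] := neg_sector_mul hq t0 hpsi.
  have sd : 0 < sin (gamma' - gamma) by apply: sin_gt0_pihalf; lra.
  have d0 : 0 <= gamma' - gamma by rewrite subr_ge0 ltW.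
  have h := sin_le_cmod_1D d0 (ltW htheta) s0.
  by rewrite div1r lef_pV2 // posrE // (lt_le_trans sd).
- move=> r _; exists 4 => H P gamma hyp /andP[sg _] q hq Q iQ.
  by apply: thm32_norm_bound hyp _ _ iQ; lra.
- move=> H P gamma hyp nnP q hq Q iQ; have [bP [nP [niP _]]] := hyp.
  (* A non-negative P satisfies the hypothesis with angle 0, where the condition on sin gamma
     becomes |q| ||P|| <= 1. *)
  have hyp0 : thm32_hyp P 0 by split=> //; split=> //; split=> //; right.
  by apply: (thm32_norm_bound hyp0 hq _ iQ); rewrite sin0 subr_ge0 ltW.
Qed.
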